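(* For every integer $k\ge 1$, each optimal solution of $G(2k+1,2k+1)$ corresponds to a permutation of the set $\{1,3,\dots,2k+1\}$. More precisely, if $S$ is an optimal solution of $G(2k+1,2k+1)$ and, for each odd $j\in\{1,3,\dots,2k+1\}$, $i_j$ denotes the unique row occupied by the cell of $S$ in column $j$ (each odd column contains exactly one cell of $S$), then $i_1i_3\cdots i_{2k+1}$ is a permutation of $\{1,3,\dots,2k+1\}$.
   Context: For integers $n,m\ge 1$, the grid $G(n,m)$ has cell set $V_{n,m}=\{(i,j): 1\le i\le n,\ 1\le j\le m\}$ ($i$ = row, $j$ = column). Contamination rules: a cell $u=(i,j)\in V_{n,m}$ can be contaminated by two contaminated cells $v,w\in V_{n,m}$ if one of the following holds: (a) $v=(i-1,j-1)$, $w=(i+1,j+1)$; (b) $v=(i+1,j-1)$, $w=(i-1,j+1)$; (c) $v=(i-1,j)$, $w=(i+1,j)$; (d) $v=(i,j-1)$, $w=(i,j+1)$; (e) $v=(i,j-1)$, $w=(i-1,j)$; (f) $v=(i,j-1)$, $w=(i+1,j)$; (g) $v=(i+1,j)$, $w=(i,j+1)$; (h) $v=(i-1,j)$, $w=(i,j+1)$. For $S\subseteq V_{n,m}$, the final contaminated set $C(S)$ is the smallest subset of $V_{n,m}$ containing $S$ and closed under rules (a)--(h). $S$ is a contaminating set if $C(S)=V_{n,m}$. The power contamination number $\gamma_c(G(n,m))$ is the minimum cardinality of a contaminating set; a contaminating set of this cardinality is an optimal solution. *)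

(* Defs.v *)
From HB Require Import structures.
From mathcomp Require Import all_boot all_order all_algebra.

Set Implicit Arguments.
Unset Strict Implicit.
Unset Printing Implicit Defensive.

Definition cell (n m : nat) : finType := ('I_n * 'I_m)%type.

(* Ordinals count from 0, whereas rows and columns of the grid are numbered
   from 1. *)
Definition row_of (n m : nat) (u : cell n m) : nat := (u.1 : 'I_n).+1.
Definition col_of (n m : nat) (u : cell n m) : nat := (u.2 : 'I_m).+1.

(* Integer coordinates, so that [row_of u - 1] is not truncated. *)
Definition at_offset (n m : nat) (u : cell n m) (di dj : int) (v : cell n m)
  : bool :=
  ((row_of v)%:Z == (row_of u)%:Z + di)%R && ((col_of v)%:Z == (col_of u)%:Z + dj)%R.

Definition can_contaminate (n m : nat) (v w u : cell n m) : bool :=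
  [|| at_offset u (-1) (-1) v && at_offset u   1    1  w,
      at_offset u   1  (-1) v && at_offset u (-1)   1  w,
      at_offset u (-1)   0  v && at_offset u   1    0  w,
      at_offset u   0  (-1) v && at_offset u   0    1  w,
      at_offset u   0  (-1) v && at_offset u (-1)   0  w,
      at_offset u   0  (-1) v && at_offset u   1    0  w,
      at_offset u   1    0  v && at_offset u   0    1  w
    | at_offset u (-1)   0  v && at_offset u   0    1  w].

Definition contam_closed (n m : nat) (T : {set cell n m}) : bool :=
  [forall v in T, forall w in T, forall u, can_contaminate v w u ==> (u \in T)].

Definition final_set (n m : nat) (S : {set cell n m}) : {set cell n m} :=
  \bigcap_(T : {set cell n m} | (S \subset T) && contam_closed T) T.

Lemma sub_final_set (n m : nat) (S : {set cell n m}) : S \subset final_set S.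
Proof. by apply/bigcapsP => T /andP[]. Qed.

Lemma final_set_closed (n m : nat) (S : {set cell n m}) :
  contam_closed (final_set S).
Proof.
apply/forall_inP => v /bigcapP Cv; apply/forall_inP => w /bigcapP Cw.
apply/forallP => u; apply/implyP => vwu; apply/bigcapP => T ST.
have /forall_inP clT : contam_closed T by case/andP: ST.
by have /forall_inP/(_ w (Cw T ST))/forallP/(_ u)/implyP := clT v (Cv T ST); apply.
Qed.

Lemma final_set_min (n m : nat) (S T : {set cell n m}) :
  S \subset T -> contam_closed T -> final_set S \subset T.
Proof. by move=> ST clT; apply: bigcap_inf; rewrite ST clT. Qed.

Definition contaminating (n m : nat) (S : {set cell n m}) : bool :=
  final_set S == [set: cell n m].

Lemma contaminatingT (n m : nat) : contaminating [set: cell n m].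
Proof. by rewrite /contaminating eqEsubset subsetT sub_final_set. Qed.

(* [arg min] is a genuine minimum because the whole grid is contaminating
   ([contaminatingT]). *)
Definition power_contamination_number (n m : nat) : nat :=
  #|[arg min_(S < [set: cell n m] | contaminating S) #|S|]|.

Definition optimal (n m : nat) (S : {set cell n m}) : bool :=
  contaminating S && (#|S| == power_contamination_number n m).

Definition odds (N : nat) : seq nat := [seq j <- iota 1 N | odd j].

(* Main.v *)
(** Group the seeds into blocks, each enclosed in a box. Start from single
   cells and keep merging blocks whose boxes contain cells at Chebyshev distance
   at most 2, replacing the boxes by their hull: the sides of the box of a block
   of [s] seeds are then at most [2 s - 1]. When nothing can be merged any more,
   the union of the boxes is closed under contamination, so it is the whole grid
   and there is a single box. For the square of side [2 k + 1] the diagonal shows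
   that an optimal solution has at most [k + 1] seeds, so the bound is attained
   in both directions. This forces every merge to leave a gap of exactly one row
   and one column, whence the seeds sit on pairwise distinct odd rows and on
   pairwise distinct odd columns. *)

Require Import Defs.
From HB Require Import structures.
From mathcomp Require Import all_boot all_order all_algebra.
From mathcomp Require Import zify.

Set Implicit Arguments.
Unset Strict Implicit.
Unset Printing Implicit Defensive.

(** * Intervals around the values of a function, and their merging *)

(** In every rule the two contaminating cells differ by at most 2 in each coordinate. *)
Definition near (p q : nat) : bool := (p <= q + 2) && (q <= p + 2).

Definition inside (I : nat * nat) (p : nat) : bool := I.1 <= p <= I.2.

Definition hull (I J : nat * nat) : nat * nat :=
  (minn I.1 J.1, maxn I.2 J.2).

(* The intervals are closed, so the length bound is [I.2 - I.1 + 1 <= 2 #|A| - 1];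
   [spread_tight] describes the equality case. *)
Record spread (T : finType) (g : T -> nat) (A : {set T}) (I : nat * nat) : Prop :=
  Spread {
    spread_le : I.1 <= I.2;
    spread_inside : {in A, forall x, inside I (g x)};
    spread_bound : I.2 + 2 <= I.1 + 2 * #|A|;
    spread_tight : I.2 + 2 = I.1 + 2 * #|A| ->
      {in A, forall x, ~~ odd (g x - I.1)} /\ {in A &, injective g}
  }.

Lemma spread1 (T : finType) (g : T -> nat) (x : T) :
  spread g [set x] (g x, g x).
Proof.
split=> /=; rewrite ?cards1 //; first by move=> y /set1P->; rewrite /inside leqnn.
by move=> _; split=> [y /set1P-> | y z /set1P-> /set1P->] //; rewrite subnn.
Qed.

(** At most one integer is missing between near intervals, so the hull has length at most
    [(2 #|A| - 1) + 1 + (2 #|B| - 1)]. Equality forces both intervals to be tight and disjoint, with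
    one integer between them. *)
Lemma spreadU (T : finType) (g : T -> nat) (A B : {set T}) I J p q :
    [disjoint A & B] -> spread g A I -> spread g B J ->
    inside I p -> inside J q -> near p q ->
  spread g (A :|: B) (hull I J).
Proof.
case: I J => [a b] [c d] dAB [/= ab inA bA tA] [/= cd inB bB tB].
rewrite /inside /near /= => /andP[ap pb] /andP[cq qd] /andP[pq qp].
have cU : #|A :|: B| = #|A| + #|B|.
  by apply/eqP; rewrite leq_card_setU.
have inU x : x \in A :|: B ->
    (x \in A) && (a <= g x <= b) || (x \in B) && (c <= g x <= d).
  by case/setUP => [xA|xB]; apply/orP; [left|right]; apply/andP; split=> //;
     [exact: inA | exact: inB].
split; rewrite ?cU /=; first by lia.
- by move=> x /inU; rewrite /inside /=; lia.
- by lia.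
move=> tight.
(* By tightness the lower ends [a] and [c] differ by [2 #|A|] or [2 #|B|], so parities carry over to
   the hull. *)
have [] : (b + 2 = a + 2 * #|A| /\ d + 2 = c + 2 * #|B|) /\
    (c = b + 2 \/ a = d + 2) by lia.
move=> [/[dup] eA /tA[oA iA] /[dup] eB /tB[oB iB]] gap.
split=> [x | x y] /inU.
  by case/orP=> /andP[]; [move/oA | move/oB]; lia.
case/orP=> /andP[xA gx] /inU /orP[] /andP[yA gy] exy.
- exact: iA.
- by lia.
- by lia.
- exact: iB.
Qed.

(** * Blocks of seeds and the merging of their boxes *)

Section Blocks.

Variables n m : nat.
Implicit Types (S : {set cell n m}) (u v w c d : cell n m).

Local Notation row := (@row_of n m).
Local Notation col := (@col_of n m).

(** A partition of the seeds is encoded by a labelling [f] with values in the cells; blocks are its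
    fibres. *)
Definition block S (f : cell n m -> cell n m) c : {set cell n m} :=
  [set x in S | f x == c].

(** This weakening of the eight rules treats rows and columns separately. *)
Lemma can_contaminateP v w u : can_contaminate v w u ->
  [/\ near (row v) (row w), near (col v) (col w),
      minn (row v) (row w) <= row u <= maxn (row v) (row w)
    & minn (col v) (col w) <= col u <= maxn (col v) (col w)].
Proof.
rewrite /can_contaminate /at_offset /near.
by repeat (case/orP); case/andP=> /andP[/eqP ? /eqP ?] /andP[/eqP ? /eqP ?];
  split; lia.
Qed.

Lemma inside_between I p q r :
  inside I p -> inside I q -> minn p q <= r <= maxn p q -> inside I r.
Proof. by rewrite /inside; lia. Qed.

Lemma contaminating_closed S (T : {set cell n m}) :
  contaminating S -> S \subset T -> contam_closed T -> T = [set: cell n m].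
Proof.
move=> /eqP CS ST clT; apply/eqP.
by rewrite eqEsubset subsetT -CS final_set_min.
Qed.

(* A box that contains every cell within Chebyshev distance 2 of each of its own
   cells is the whole grid. *)
Lemma inside_total (I J : nat * nat) u :
    inside I (row u) -> inside J (col u) ->
    (forall v w, inside I (row v) -> inside J (col v) ->
       near (row v) (row w) -> near (col v) (col w) ->
       inside I (row w) && inside J (col w)) ->
  forall w, inside I (row w) /\ inside J (col w).
Proof.
case: I J u => [a b] [c d] [[i ltin] [j ltjm]].
rewrite /inside /near /row_of /col_of /= => Ii Jj step [[i' lti'] [j' ltj']] /=.
have at_nat (v1 v2 : nat) (l1 : v1 < n) (l2 : v2 < m)
    (w1 w2 : nat) (k1 : w1 < n) (k2 : w2 < m) :=
  step (Ordinal l1, Ordinal l2) (Ordinal k1, Ordinal k2).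
rewrite /= in at_nat; split.
- apply/andP; split; rewrite leqNgt; apply/negP => out.
  (* Indices are one less than rows: [a.-1] is the first row of the box and [a.-2] the row before
     it, which exists by [out]. *)
  + have l1 : a.-1 < n by lia.
    have l0 : a.-2 < n by lia.
    by have := at_nat _ _ l1 ltjm _ _ l0 ltjm; lia.
  + have l1 : b.-1 < n by lia.
    have l0 : b < n by lia.
    by have := at_nat _ _ l1 ltjm _ _ l0 ltjm; lia.
- apply/andP; split; rewrite leqNgt; apply/negP => out.
  + have l1 : c.-1 < m by lia.
    have l0 : c.-2 < m by lia.
    by have := at_nat _ _ ltin l1 _ _ ltin l0; lia.
  + have l1 : d.-1 < m by lia.
    have l0 : d < m by lia.
    by have := at_nat _ _ ltin l1 _ _ ltin l0; lia.
Qed.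

Definition touching (I J : cell n m -> nat * nat) c d : bool :=
  [exists v, exists w,
    [&& inside (I c) (row v), inside (J c) (col v),
        inside (I d) (row w), inside (J d) (col w),
        near (row v) (row w) & near (col v) (col w)]].

Lemma touchingP I J c d v w :
    inside (I c) (row v) -> inside (J c) (col v) ->
    inside (I d) (row w) -> inside (J d) (col w) ->
    near (row v) (row w) -> near (col v) (col w) ->
  touching I J c d.
Proof.
by move=> *; apply/existsP; exists v; apply/existsP; exists w; apply/and5P; split;
  rewrite //; apply/andP.
Qed.

(** Cells that jointly contaminate a third lie in touching boxes, hence in the same box, and boxes
    are convex; so the union of the boxes is closed. *)
Lemma untouched_single S f I J :
    contaminating S -> 0 < n -> 0 < m ->
    {in f @: S, forall c, spread row (block S f c) (I c)} ->
    {in f @: S, forall c, spread col (block S f c) (J c)} ->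
    {in f @: S &, forall c d, touching I J c d -> c = d} ->
  exists c, [/\ c \in f @: S, block S f c = S
    & forall w, inside (I c) (row w) /\ inside (J c) (col w)].
Proof.
move=> CS n0 m0 spI spJ apart.
pose U := [set u | [exists (c | c \in f @: S),
  inside (I c) (row u) && inside (J c) (col u)]].
have UP u : reflect (exists c, [/\ c \in f @: S, inside (I c) (row u)
    & inside (J c) (col u)]) (u \in U).
  rewrite inE; apply: (iffP existsP) => -[c].
    by case/and3P=> ? ? ?; exists c.
  by case=> ? ? ?; exists c; apply/and3P.
have seed x : x \in S -> f x \in f @: S /\ x \in block S f (f x).
  by move=> xS; rewrite imset_f // inE xS eqxx.
have insideS x : x \in S ->
    inside (I (f x)) (row x) /\ inside (J (f x)) (col x).
  move=> xS; have [fx xb] := seed x xS.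
  by split; [apply: (spread_inside (spI _ fx)) | apply: (spread_inside (spJ _ fx))].
have UT : U = [set: cell n m].
  apply: contaminating_closed CS _ _.
    apply/subsetP => x xS; apply/UP; exists (f x).
    by have [? ?] := insideS x xS; have [? _] := seed x xS.
  apply/forall_inP => v /UP[c [cS vI vJ]].
  apply/forall_inP => w /UP[d [dS wI wJ]].
  apply/forallP => u; apply/implyP => /can_contaminateP[nI nJ bI bJ].
  have ecd : c = d by apply: apart => //; apply: touchingP nI nJ.
  rewrite -{}ecd in wI wJ; apply/UP; exists c.
  by split=> //; [apply: inside_between bI | apply: inside_between bJ].
have /UP[c [cS uI uJ]] : (Ordinal n0, Ordinal m0) \in U by rewrite UT inE.
(* A cell near the box of [c] is covered by some box, which touches that of [c] and so equals it. *)
have total w : inside (I c) (row w) /\ inside (J c) (col w).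
  apply: inside_total uI uJ _ w => v w vI vJ nI nJ.
  have /UP[d [dS wI wJ]] : w \in U by rewrite UT inE.
  have ecd : c = d by apply: apart => //; apply: touchingP nI nJ.
  by rewrite ecd wI wJ.
exists c; split=> //.
(* A seed lies in its own box and in that of [c], so the two boxes touch at the seed. *)
apply/setP => x; rewrite inE; case xS: (x \in S) => //=; apply/eqP.
have [fx _] := seed x xS; have [xI xJ] := insideS x xS; have [yI yJ] := total x.
by apply: apart => //; apply: (@touchingP _ _ _ _ x x) => //; rewrite /near; lia.
Qed.

Lemma contaminating_spread S : contaminating S -> 0 < n -> 0 < m ->
  exists I J, [/\ spread row S I, spread col S J
    & forall w, inside I (row w) /\ inside J (col w)].
Proof.
move=> CS n0 m0.
(* Induction on a bound [N] for the number of labels, starting from [id], which makes every seed a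
   block. *)
suff blocks N f I J : #|f @: S| <= N ->
    {in f @: S, forall c, spread row (block S f c) (I c)} ->
    {in f @: S, forall c, spread col (block S f c) (J c)} ->
    exists I J, [/\ spread row S I, spread col S J
      & forall w, inside I (row w) /\ inside J (col w)].
  have block1 x : x \in S -> block S id x = [set x].
    by move=> xS; apply/setP=> y; rewrite !inE andbC; case: eqP => // ->.
  apply: (blocks #|S| id (fun x => (row x, row x)) (fun x => (col x, col x))).
  - by rewrite imset_id.
  - by move=> c; rewrite imset_id => /block1->; apply: spread1.
  - by move=> c; rewrite imset_id => /block1->; apply: spread1.
elim: N f I J => [|N IHN] f I J cardf spI spJ.
  (* Without labels separation is vacuous, yet [untouched_single] yields a label: a
     contradiction. *)
  have apart : {in f @: S &, forall c d, touching I J c d -> c = d}.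
    by move: cardf; rewrite leqn0 cards_eq0 => /eqP-> c d; rewrite inE.
  have [c [_ <- tot]] := untouched_single CS n0 m0 spI spJ apart.
  by have [c' [c'S]] := untouched_single CS n0 m0 spI spJ apart;
     move: cardf c'S; rewrite leqn0 cards_eq0 => /eqP->; rewrite inE.
have [|none] := boolP [exists c, exists d,
  [&& c \in f @: S, d \in f @: S, c != d & touching I J c d]]; last first.
  have apart : {in f @: S &, forall c d, touching I J c d -> c = d}.
    move=> c d cS dS tcd; apply/eqP; apply: contraNT none => ncd.
    by apply/existsP; exists c; apply/existsP; exists d; apply/and4P.
  have [c [cS bS tot]] := untouched_single CS n0 m0 spI spJ apart.
  by exists (I c), (J c); split; rewrite // -bS; auto.
case/existsP=> c /existsP[d /and4P[cS dS ncd]].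
case/existsP=> v /existsP[w /and5P[vI vJ wI wJ /andP[nI nJ]]].
(* Block [d] is absorbed into block [c], so the label [d] disappears. *)
pose f' x := if f x == d then c else f x.
pose up (K : cell n m -> nat * nat) x := if x == c then hull (K c) (K d) else K x.
have f'S : f' @: S \subset (f @: S) :\ d.
  apply/subsetP => _ /imsetP[x xS ->]; rewrite /f' !inE.
  by case: ifP => [_|->]; rewrite ?ncd // imset_f.
have blockc : block S f' c = block S f c :|: block S f d.
  apply/setP=> x; rewrite !inE /f' -andb_orr; congr (_ && _).
  by case: (f x == d); rewrite ?eqxx ?orbT ?orbF.
have blockx x : x != c -> x != d -> block S f' x = block S f x.
  move=> xc xd; apply/setP=> y; rewrite !inE /f'; congr (_ && _).
  by case: (f y =P d) => // ->; rewrite !(eq_sym _ x) (negbTE xc) (negbTE xd).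
have dis : [disjoint block S f c & block S f d].
  apply/pred0P => x; rewrite /= !inE; case: eqP => [->|]; last by rewrite andbF.
  by rewrite (negbTE ncd) !andbF.
have merge g K p q : {in f @: S, forall c, spread g (block S f c) (K c)} ->
    inside (K c) p -> inside (K d) q -> near p q ->
    {in f' @: S, forall c, spread g (block S f' c) (up K c)}.
  move=> spK pK qK npq x /(subsetP f'S); rewrite in_setD1 /up => /andP[xd xS].
  case: eqVneq => [->|xc]; last by rewrite blockx //; apply: spK.
  by rewrite blockc; apply: spreadU npq => //; apply: spK.
apply: (IHN f' (up I) (up J)); [|exact: merge nI|exact: merge nJ].
apply: leq_trans (subset_leq_card f'S) _.
by move: cardf; rewrite (cardsD1 d) dS.
Qed.

End Blocks.

(** * The diagonal as an upper bound *)

Lemma card_power_contamination (n m : nat) (S D : {set cell n m}) :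
  optimal S -> contaminating D -> #|S| <= #|D|.
Proof.
case/andP=> _ /eqP-> CD; rewrite /power_contamination_number.
by case: arg_minnP => [|A _]; [exact: contaminatingT | apply].
Qed.

(** Even indices are odd rows: these are the cells (1,1), (3,3), ..., (2k+1,2k+1). *)
Definition even_diagonal (k : nat) : {set cell (2 * k + 1) (2 * k + 1)} :=
  [set c : cell (2 * k + 1) (2 * k + 1) | (c.1 == c.2) && ~~ odd c.1].

Lemma card_even_diagonal k : #|even_diagonal k| <= k.+1.
Proof.
have lt2 (i : 'I_k.+1) : 2 * i < 2 * k + 1 by case: i => /= i; lia.
pose h i : cell (2 * k + 1) (2 * k + 1) := (Ordinal (lt2 i), Ordinal (lt2 i)).
rewrite -[leqRHS]card_ord -cardsT; apply: leq_trans (leq_imset_card h _).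
apply/subset_leq_card/subsetP => -[[i ik] j].
rewrite inE /= => /andP[/eqP<- oi].
have lti : i./2 < k.+1 by lia.
by apply/imsetP; exists (Ordinal lti); rewrite ?inE //; congr (_, _);
  apply: val_inj => /=; lia.
Qed.

(** Rule (a) fills the main diagonal; then rules (f) and (h) fill the parallels on either side, one
    distance [d] after the other. *)
Lemma contaminating_even_diagonal k : contaminating (even_diagonal k).
Proof.
apply/eqP/setP => u; rewrite inE; apply/bigcapP => T /andP[DT clT].
pose N := 2 * k + 1.
(* Vacuous outside the grid, so the induction on [d] can range over all [i]. *)
pose In i j := forall (li : i < N) (lj : j < N), (Ordinal li, Ordinal lj) \in T.
have close v w x : v \in T -> w \in T -> can_contaminate v w x -> x \in T.
  move=> vT wT; move/forall_inP/(_ v vT)/forall_inP/(_ w wT): clT.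
  by move/forallP/(_ x)/implyP.
have diag i : In i i.
  move=> li lj; have [oi|ei] := boolP (odd i); last first.
    by apply: (subsetP DT); rewrite inE ei andbT; apply/eqP/val_inj.
  have l0 : i.-1 < N by lia.
  have l2 : i.+1 < N by lia.
  apply: (close (Ordinal l0, Ordinal l0) (Ordinal l2, Ordinal l2)).
  - by apply: (subsetP DT); rewrite inE eqxx /=; lia.
  - by apply: (subsetP DT); rewrite inE eqxx /=; lia.
  by rewrite /can_contaminate /at_offset /row_of /col_of /=; lia.
have off d : forall i, In i (i + d) /\ In (i + d) i.
  elim: d => [|d IHd] i; first by rewrite addn0; split; apply: diag.
  have [Iu Id] := IHd i; have [Iu' Id'] := IHd i.+1.
  split=> li lj.
  - have l1 : i + d < N by lia.
    have l2 : i.+1 < N by lia.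
    have l3 : i.+1 + d < N by lia.
    apply: close (Iu li l1) (Iu' l2 l3) _.
    by rewrite /can_contaminate /at_offset /row_of /col_of /=; lia.
  - have l1 : i + d < N by lia.
    have l2 : i.+1 < N by lia.
    have l3 : i.+1 + d < N by lia.
    apply: close (Id l1 lj) (Id' l3 l2) _.
    by rewrite /can_contaminate /at_offset /row_of /col_of /=; lia.
case: u => [[i li] [j lj]]; have [le_ij|/ltnW le_ji] := leqP i j.
  by have [+ _] := off (j - i) i; rewrite subnKC //; apply.
by have [_ +] := off (i - j) j; rewrite subnKC //; apply.
Qed.

(** * The equality case *)

Lemma mem_odds N j : (j \in odds N) = odd j && (j <= N).
Proof. by rewrite mem_filter mem_iota; lia. Qed.

Lemma odds_uniq N : uniq (odds N).
Proof. exact: filter_uniq (iota_uniq _ _). Qed.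

Lemma size_odds k : size (odds (2 * k + 1)) = k.+1.
Proof.
rewrite size_filter; elim: k => // k IHk.
have -> : 2 * k.+1 + 1 = (2 * k + 1) + 2 by lia.
by rewrite iotaD count_cat IHk /= addn0; lia.
Qed.

(** Containing 1 and [2 * k + 1] requires length at least [2 * k + 1], the most that [k.+1] elements
    allow. So the bound is tight and the interval starts at 1, where even offsets are odd values. *)
Lemma spread_odds (T : finType) (g : T -> nat) (A : {set T}) k I :
    spread g A I -> #|A| <= k.+1 -> inside I 1 -> inside I (2 * k + 1) ->
    (forall x, 0 < g x <= 2 * k + 1) ->
  [/\ #|A| = k.+1, {in A, forall x, g x \in odds (2 * k + 1)}
    & {in A &, injective g}].
Proof.
case: I => a b [/= ab inA bA tA] cA /andP[/= a1 _] /andP[_ /= kb] gk.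
have [|oA iA] := tA _; first by lia.
split=> // [|x xA]; first by lia.
by rewrite mem_odds; have := oA x xA; have := gk x; have := inA x xA;
  rewrite /inside /=; lia.
Qed.

Theorem proposition9 (k : nat) (k_ge1 : 1 <= k)
    (S : {set cell (2 * k + 1) (2 * k + 1)}) (S_opt : optimal S) :
  (forall j : nat, j \in odds (2 * k + 1) -> #|[set c in S | col_of c == j]| = 1)
  /\ (forall i : nat -> nat,
        (forall j : nat, j \in odds (2 * k + 1) ->
           exists2 c, c \in S & row_of c = i j /\ col_of c = j) ->
        perm_eq [seq i j | j <- odds (2 * k + 1)] (odds (2 * k + 1))
        /\ S = [set c | (col_of c \in odds (2 * k + 1)) && (row_of c == i (col_of c))]).
Proof.
have [CS _] := andP S_opt.
have cS : #|S| <= k.+1.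
  apply: leq_trans (card_even_diagonal k).
  exact: card_power_contamination S_opt (contaminating_even_diagonal k).
have l0 : 0 < 2 * k + 1 by lia.
have lk : 2 * k < 2 * k + 1 by lia.
have [I [J [spI spJ tot]]] := contaminating_spread CS l0 l0.
(* Two opposite corners put 1 and [2 * k + 1] into both [I] and [J]. *)
have [I1 J1] := tot (Ordinal l0, Ordinal l0).
have [Ik Jk] := tot (Ordinal lk, Ordinal lk).
rewrite /row_of /col_of /= -(addn1 (2 * k)) in I1 J1 Ik Jk.
have [|cardS rowS rowI] := spread_odds spI cS I1 Ik _.
  by case=> [[r lr] s]; rewrite /row_of /=; lia.
have [|_ colS colI] := spread_odds spJ cS J1 Jk _.
  by case=> [r [s ls]]; rewrite /col_of /=; lia.
(* Counting: [k.+1] distinct odd columns exhaust the odd columns. *)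
have colsS : [seq col_of c | c in S] =i odds (2 * k + 1).
  have uS : uniq [seq col_of c | c in S].
    rewrite map_inj_in_uniq ?enum_uniq // => x y.
    by rewrite !mem_enum; apply: colI.
  have [||_ //] := uniq_min_size uS (s2 := odds (2 * k + 1)).
  - by move=> _ /imageP[x xS ->]; apply: colS.
  - by rewrite size_odds size_image cardS.
split=> [j|i iP].
  rewrite -colsS => /imageP[c cS' ->]; apply/eqP/cards1P; exists c.
  apply/setP=> x; rewrite !inE; apply/andP/eqP => [[xS /eqP ex]|-> //].
  exact: colI.
have i_odds j : j \in odds (2 * k + 1) -> i j \in odds (2 * k + 1).
  by case/iP=> c cS' [<- _]; apply: rowS.
split.
  (* Equal rows give the same seed by [rowI], hence equal columns. *)
  have ui : uniq [seq i j | j <- odds (2 * k + 1)].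
    rewrite map_inj_in_uniq ?odds_uniq // => j j'.
    case/iP=> c cS' [<- <-]; case/iP=> c' cS'' [<- <-] e.
    by rewrite (rowI c c').
  apply: uniq_perm; rewrite ?odds_uniq //.
  have [||_ //] := uniq_min_size ui (s2 := odds (2 * k + 1)).
  - by move=> _ /mapP[j jO ->]; apply: i_odds.
  - by rewrite size_map.
apply/setP=> c; rewrite inE; apply/idP/andP => [cS'|[cO /eqP rc]].
  split; first exact: colS.
  by have [d dS [<- cd]] := iP _ (colS c cS'); rewrite (colI c d).
have [d dS [rd cd]] := iP _ cO.
suff -> : c = d by [].
case: c d {cO dS} rc rd cd => [c1 c2] [d1 d2].
rewrite /row_of /col_of /= => <- [e1] [e2].
by congr (_, _); apply: val_inj.
Qed.
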